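(* Let $J$ be a finite set of jobs, job $j$ having processing time $p_j>0$ and weight $w_j>0$. The procedure $\mathrm{FastSchedule}$ described in the context, called as $\mathrm{FastSchedule}(J,0)$, returns an ordering of $J$ that minimizes $\sum_{j\in J}-w_j/C_j$ (equivalently maximizes $\sum_{j\in J}w_j/C_j$) over all orderings of $J$, together with this optimal value.
   Context: Jobs and schedules. $J$ is a finite set of jobs; job $j$ has processing time $p_j>0$ and weight $w_j>0$; $T=\sum_{j\in J}p_j$. A schedule is an ordering of $J$ processed consecutively without idle time from time $0$; job $j$ has start time $t_j$ and completion time $C_j=t_j+p_j$. Auxiliary quantities. For a job $j$ and $t\ge 0$ let $\varphi_j(t)=\frac{w_j}{p_j(p_j+t)}$. For two jobs $i,j$ with $w_ip_j\neq w_jp_i$ let $t^*_{ij}=\frac{w_jp_i^2-w_ip_j^2}{w_ip_j-w_jp_i}$ (symmetric in $i,j$; the unique real $t$ with $\varphi_i(t)=\varphi_j(t)$). Banned sets. For $i\in J$, let $B_i$ be the union, over all $j\in J\setminus\{i\}$ with $\varphi_i(0)>\varphi_j(0)$, $w_ip_j\ne w_jp_i$ and $t^*_{ij}\in(0,T)$, of the intervals $[t^*_{ij},t^*_{ij}+p_j)$. Subproblem data. For $J'\subseteq J$ and $t_o\ge0$ let $t_e=t_o+\sum_{j\in J'}p_j$. Let $\alpha\in J'$ maximize $\varphi_i(t_o)$ over $i\in J'$, ties broken in favour of maximum $\varphi_i(t_e)$. For $j\in J'\setminus\{\alpha\}$ with $t^*_{\alpha j}$ defined put $c_{\alpha j}=t^*_{\alpha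 j}+p_j$. Let $C=\{c_{\alpha j}: j\in J'\setminus\{\alpha\},\ t^*_{\alpha j}\text{ defined},\ c_{\alpha j}\in(t_o,t_e)\}\cup\{t_o,t_e\}$ and list its distinct elements as $t_o=c_1<c_2<\dots<c_m=t_e$. Define $M(\alpha)=1$; for $j\ne\alpha$, $M(j)=r$ if $t^*_{\alpha j}$ is defined, $t^*_{\alpha j}\in(t_o,t_e)$ and $c_{\alpha j}=c_r$ for some $r\le m$; and $M(j)=|J'|+1$ otherwise. Procedure $\mathrm{FastSchedule}(J',t)$: if $J'=\emptyset$ return value $0$ and the empty sequence; if $J'=\{j\}$ return value $w_j/(p_j+t)$ and the sequence $(j)$. Otherwise compute, with $t_o=t$, the job $\alpha$, the points $c_1<\dots<c_m$ and $M$. For each $q=1,\dots,m-1$ let $J_l^q=\{j\in J'\setminus\{\alpha\}:M(j)\le q\}$, $J_r^q=\{j\in J':M(j)>q\}$ and $s_q=t+\sum_{j\in J_l^q}p_j$. If $c_q\le s_q<c_{q+1}$ and $s_q\notin B_\alpha$, recursively compute $(v_l,\sigma_l)=\mathrm{FastSchedule}(J_l^q,t)$ and $(v_r,\sigma_r)=\mathrm{FastSchedule}(J_r^q,s_q+p_\alpha)$ and form the candidate of value $v_l+v_r+w_\alpha/(s_q+p_\alpha)$ with sequence $\sigma_l,\alpha,\sigma_r$. Return the candidate of maximum value. *)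

(* Defs.v *)
From HB Require Import structures.
From mathcomp Require Import all_boot all_order all_algebra.
Set Implicit Arguments. Unset Strict Implicit. Unset Printing Implicit Defensive.
Import Order.TTheory GRing.Theory Num.Theory.
Local Open Scope ring_scope.

Section FastSchedule.
Variables (R : realFieldType) (T : finType) (p w : T -> R).

Fixpoint sched_value (t : R) (s : seq T) : R :=
  match s with
  | [::] => 0
  | j :: s' => w j / (t + p j) + sched_value (t + p j) s'
  end.

Definition is_schedule (s : seq T) : Prop := perm_eq s (enum T).

Definition total : R := \sum_(j : T) p j.

Definition phi (j : T) (t : R) : R := w j / (p j * (p j + t)).

Definition tstar_defined (i j : T) : bool := w i * p j != w j * p i.

Definition tstar (i j : T) : R :=
  (w j * p i ^+ 2 - w i * p j ^+ 2) / (w i * p j - w j * p i).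

Definition in_banned (i : T) (s : R) : bool :=
  [exists j : T, [&& j != i, phi j 0 < phi i 0, tstar_defined i j,
                   0 < tstar i j < total & tstar i j <= s < tstar i j + p j]].

Definition t_end (J' : {set T}) (t : R) : R := t + \sum_(j in J') p j.

Definition alpha_spec (J' : {set T}) (t : R) (a : T) : Prop :=
  a \in J' /\
  forall i, i \in J' ->
    phi i t <= phi a t /\
    (phi i t = phi a t -> phi i (t_end J' t) <= phi a (t_end J' t)).

Variable sel : {set T} -> R -> T.  (* the chosen alpha for (J', t) *)

Definition cval (a j : T) : R := tstar a j + p j.

Definition cpoints (J' : {set T}) (t : R) : seq R :=
  let a := sel J' t in let te := t_end J' t in
  sort <=%R (undup (t :: te :: [seq cval a j | j <- enum J' &
      [&& j != a, tstar_defined a j & t < cval a j < te]])).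

(* c_r, 1-based *)
Definition cpt (J' : {set T}) (t : R) (r : nat) : R := nth 0 (cpoints J' t) r.-1.

Definition Mfun (J' : {set T}) (t : R) (j : T) : nat :=
  let a := sel J' t in let cs := cpoints J' t in
  if j == a then 1%N
  else if [&& tstar_defined a j, t < tstar a j < t_end J' t & cval a j \in cs]
       then (index (cval a j) cs).+1
       else #|J'|.+1.

Definition Jl (J' : {set T}) (t : R) (q : nat) : {set T} :=
  [set j in J' | (j != sel J' t) && (Mfun J' t j <= q)%N].
Definition Jr (J' : {set T}) (t : R) (q : nat) : {set T} :=
  [set j in J' | (q < Mfun J' t j)%N].
Definition sq (J' : {set T}) (t : R) (q : nat) : R := t + \sum_(j in Jl J' t q) p j.

(* candidate of maximum value (ties: first maximal one) *)
Definition best (cs : seq (R * seq T)) : option (R * seq T) :=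
  foldr (fun c acc => match acc with
                      | None => Some c
                      | Some b => if b.1 <= c.1 then Some c else Some b
                      end) None cs.

(* fuel-based recursion; the fuel #|J'| is always sufficient since the
   recursive calls are on strict subsets.  None signals a failure
   (no candidate, or a failing recursive call). *)
Fixpoint fs (n : nat) (J' : {set T}) (t : R) : option (R * seq T) :=
  if #|J'| == 0%N then Some (0, [::]) else
  if #|J'| == 1%N then
    (if [pick j in J'] is Some j then Some (w j / (p j + t), [:: j]) else None)
  else match n with
  | 0%N => None
  | n'.+1 =>
    let a := sel J' t in
    let m := size (cpoints J' t) in
    let cands := [seq (let s := sq J' t q in
                       match fs n' (Jl J' t q) t, fs n' (Jr J' t q) (s + p a) with
                       | Some (vl, sl), Some (vr, sr) =>
                           Some (vl + vr + w a / (s + p a), sl ++ a :: sr)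
                       | _, _ => None
                       end)
                 | q <- iota 1 m.-1 &
                   [&& cpt J' t q <= sq J' t q, sq J' t q < cpt J' t q.+1
                     & ~~ in_banned a (sq J' t q)]] in
    if all isSome cands then best (pmap id cands) else None
  end.

Definition FastSchedule (J' : {set T}) (t : R) : option (R * seq T) :=
  fs #|J'| J' t.

End FastSchedule.

(* Main.v *)
Require Import Defs.
From HB Require Import structures.
From mathcomp Require Import all_boot all_order all_algebra.
From mathcomp Require Import ring lra.
Import Order.TTheory GRing.Theory Num.Theory.
Local Open Scope ring_scope.

(** Write [phi_i(t) >= phi_j(t)] as [delta i j t >= 0], where [delta] is affine
in [t]; this says that, of two adjacent jobs started at [t], [i] should go first.
The comparison extends to non-adjacent jobs: if a block [j A i] is optimal, then
mixing the blocks [A i j], [i A j] and [i j A] with suitable weights makes the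
contribution of [A] no worse (convexity of [1/z]), while [i] and [j] gain as soon
as [delta i j] is nonnegative at the appropriate time. Hence an optimal schedule,
with ties broken suitably, puts before [alpha] exactly the jobs [j] with
[t*_{alpha j} + p_j <= s], [s] being the start of [alpha], and [s] is not banned
by a job of the subproblem. The bans due to jobs outside a subproblem never apply
inside it: this is preserved by both recursive calls, so that no call runs out of
candidates. *)

Section FastScheduleOptimal.

Variables (R : realFieldType) (T : finType) (p w : T -> R).
Hypotheses (hp : forall j, 0 < p j) (hw : forall j, 0 < w j).

Local Notation sv := (sched_value p w).
Local Notation phi := (phi p w).
Local Notation tstar := (tstar p w).
Local Notation tdef := (tstar_defined p w).
Local Notation tend := (t_end p).

(** * Durations and values of sequences *)

Definition dur (s : seq T) : R := \sum_(j <- s) p j.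

Lemma dur_nil : dur [::] = 0. Proof. exact: big_nil. Qed.

Lemma dur_cons j s : dur (j :: s) = p j + dur s. Proof. exact: big_cons. Qed.

Lemma dur_cat s1 s2 : dur (s1 ++ s2) = dur s1 + dur s2.
Proof. exact: big_cat. Qed.

Lemma perm_dur s1 s2 : perm_eq s1 s2 -> dur s1 = dur s2.
Proof. exact: perm_big. Qed.

Lemma dur_ge0 s : 0 <= dur s.
Proof. by apply: sumr_ge0 => j _; apply: ltW. Qed.

Lemma dur_gt0 s : s != [::] -> 0 < dur s.
Proof.
case: s => // j s _; rewrite dur_cons.
by move: (hp j) (dur_ge0 s); lra.
Qed.

Lemma sched_value_cat t s1 s2 : sv t (s1 ++ s2) = sv t s1 + sv (t + dur s1) s2.
Proof.
elim: s1 t => [|j s1 IH] t /=; first by rewrite dur_nil addr0 add0r.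
by rewrite IH dur_cons !addrA.
Qed.

(** * The affine comparison of two jobs *)

Definition delta (i j : T) (t : R) : R :=
  w i * p j * (p j + t) - w j * p i * (p i + t).

Lemma deltaC i j t : delta j i t = - delta i j t.
Proof. by rewrite /delta opprB. Qed.

Lemma phi_sub i j t : 0 <= t ->
  phi i t - phi j t = delta i j t / (p i * (p i + t) * (p j * (p j + t))).
Proof.
move=> t0; rewrite /Defs.phi /delta.
have := hp i; have := hp j => hi hj.
by field; rewrite ?gt_eqF //=; lra.
Qed.

Lemma phi_den_gt0 i j t : 0 <= t -> 0 < p i * (p i + t) * (p j * (p j + t)).
Proof.
by move=> t0; move: (hp i) (hp j) => hi hj; rewrite !mulr_gt0 //; lra.
Qed.

Lemma phi_leE i j t : 0 <= t -> (phi j t <= phi i t) = (0 <= delta i j t).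
Proof.
move=> t0; rewrite -subr_ge0 phi_sub // pmulr_lge0 //.
by rewrite invr_gt0 phi_den_gt0.
Qed.

Lemma phi_ltE i j t : 0 <= t -> (phi j t < phi i t) = (0 < delta i j t).
Proof.
move=> t0; rewrite -subr_gt0 phi_sub // pmulr_lgt0 //.
by rewrite invr_gt0 phi_den_gt0.
Qed.

Lemma phi_eqE i j t : 0 <= t -> (phi j t == phi i t) = (delta i j t == 0).
Proof.
move=> t0; rewrite !eq_le (phi_leE i j) // (phi_leE j i) // (deltaC i j) oppr_ge0.
by rewrite andbC.
Qed.

Lemma delta_tstar i j t : tdef i j ->
  delta i j t = (w i * p j - w j * p i) * (t - tstar i j).
Proof.
move=> d; rewrite /delta /Defs.tstar; field.
by rewrite subr_eq0.
Qed.

(** * Exchanging two jobs around a block *)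

(** The value of [A] shifted by [d] is a positive combination of terms [1 / (z + d)], where [z] runs
    over the completion times of [A] started at [x], all in [(x, x + dur A]]. So a termwise
    comparison suffices. *)
Lemma sched_value_mix (l1 l2 l3 d1 d2 d3 x : R) (A : seq T) :
  (forall z, x < z -> z <= x + dur A ->
     l3 / (z + d3) <= l1 / (z + d1) + l2 / (z + d2)) ->
  l3 * sv (x + d3) A <= l1 * sv (x + d1) A + l2 * sv (x + d2) A.
Proof.
elim: A x => [|k A IH] x H /=; first by rewrite !mulr0 addr0.
have := hp k => hk; have h0 := dur_ge0 A.
have h1 : l3 * sv (x + p k + d3) A
          <= l1 * sv (x + p k + d1) A + l2 * sv (x + p k + d2) A.
  by apply: IH => z z1 z2; apply: H; rewrite ?dur_cons; lra.
have := H (x + p k); rewrite dur_cons.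
rewrite ltrDl lerD2l lerDl => /(_ hk h0) h2.
have := hw k => hwk.
have h3 : w k * (l3 / (x + p k + d3)) <=
          w k * (l1 / (x + p k + d1) + l2 / (x + p k + d2)) by rewrite ler_pM2l.
rewrite ![x + _ + p k]addrAC.
lra.
Qed.

(** Turns a gain of the mixture into a gain of one actual block, without deciding which. *)
Lemma mix_gt (l1 l2 v0 v1 v2 : R) : 0 <= l1 -> 0 <= l2 ->
  0 < l1 * (v1 - v0) + l2 * (v2 - v0) -> v0 < v1 \/ v0 < v2.
Proof.
move=> h1 h2 h; case: (ltP v0 v1) => [|g1]; first by left.
case: (ltP v0 v2) => [|g2]; first by right.
have : l1 * (v1 - v0) <= 0 by rewrite mulr_ge0_le0 // subr_le0.
have : l2 * (v2 - v0) <= 0 by rewrite mulr_ge0_le0 // subr_le0.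
lra.
Qed.

Lemma perm_swap_ends (i j : T) A : perm_eq (i :: A ++ [:: j]) (j :: A ++ [:: i]).
Proof.
apply/permP => u; rewrite /= !count_cat /= !addn0.
by rewrite addnCA [RHS]addnCA (addnC (u i)).
Qed.

Lemma perm_head_last (i j : T) A : perm_eq (A ++ [:: i; j]) (j :: A ++ [:: i]).
Proof.
apply/permP => u; rewrite /= !count_cat /= !addn0.
by rewrite [RHS]addnCA (addnC (u i)).
Qed.

(* The weights [l2] of [A i j] and [l3] of [i A j] are such that [A] is not worse
   off, with equality for a job completing at the end of [A]. *)
Lemma exchange_long x A i j : 0 <= x -> p j <= p i -> 0 <= delta i j x ->
  (0 < delta i j x) || ((p j < p i) && (A != [::])) ->
  exists2 B, perm_eq B (j :: A ++ [:: i]) & sv x (j :: A ++ [:: i]) < sv x B.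
Proof.
move=> x0 le_ji d0 str.
pose a := dur A; have a0 : 0 <= a := dur_ge0 A.
have := hp i; have := hp j; have := hw i; have := hw j => wj wi pj pi.
pose l2 := (p i - p j) * (x + a); pose l3 := p j * (x + a + p i).
have l20 : 0 <= l2 by rewrite mulr_ge0 //; lra.
have l30 : 0 < l3 by rewrite mulr_gt0 //; lra.
have hA : (l2 + l3) * sv (x + p j) A <= l2 * sv (x + 0) A + l3 * sv (x + p i) A.
  apply: sched_value_mix => z z1 z2; rewrite -/a in z2.
  rewrite -subr_ge0.
  have -> : l2 / (z + 0) + l3 / (z + p i) - (l2 + l3) / (z + p j) =
    (p i - p j) * p i * p j * (x + a - z) / (z * (z + p i) * (z + p j)).
    by rewrite /l2 /l3; field; rewrite ?gt_eqF //=; lra.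
  by rewrite divr_ge0 // !mulr_ge0 //; lra.
have [] := @mix_gt l2 l3 (sv x (j :: A ++ [:: i])) (sv x (A ++ [:: i; j]))
  (sv x (i :: A ++ [:: j])) l20 (ltW l30); last first.
- exists (i :: A ++ [:: j]) => //.
  exact: perm_swap_ends.
- exists (A ++ [:: i; j]) => //.
  exact: perm_head_last.
rewrite /= !sched_value_cat /= -/a !addr0.
pose s := x + a + p j.
pose g := l3 * (a + p j) / ((x + p i) * (s + p i)) +
          l2 * p j / ((x + a + p i) * (s + p i)).
have g0 : 0 < g.
  rewrite ltr_pwDl //; first by rewrite divr_gt0 // !mulr_gt0 // /s; lra.
  by rewrite divr_ge0 // ?mulr_ge0 // /s; lra.
(* [D] is what [i] and [j] alone gain in the mixture: a positive multiple of [delta i j x], and a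
   remainder that is positive exactly when [p j < p i] and [A] is nonempty. *)
pose D := delta i j x * g / (p j * (x + p j)) +
  w j * (a * p i * (p i - p j) * p i / (x + a + p i)) / ((x + p j) * (s + p i)).
have D0 : 0 < D.
  have t1 : 0 <= delta i j x * g / (p j * (x + p j)).
    by rewrite divr_ge0 // !mulr_ge0 //; lra.
  have t2 : 0 <= w j * (a * p i * (p i - p j) * p i / (x + a + p i)) / ((x + p j) * (s + p i)).
    by rewrite !mulr_ge0 // ?invr_ge0 ?mulr_ge0 // /s; lra.
  case/orP: str => [h|/andP[h1 h2]].
    rewrite ltr_pwDl //.
    by rewrite divr_gt0 // !mulr_gt0 //; lra.
  rewrite ltr_wpDl //.
  have := dur_gt0 _ h2; rewrite -/a => a1.
  by rewrite !mulr_gt0 // ?invr_gt0 ?mulr_gt0 // /s; lra.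
rewrite addr0 in hA.
suff : l2 * (sv x A + (w i / (x + a + p i) + w j / (x + a + p i + p j)) -
   (w j / (x + p j) + (sv (x + p j) A + w i / (x + p j + a + p i)))) +
  l3 * (w i / (x + p i) + (sv (x + p i) A + w j / (x + p i + a + p j)) -
   (w j / (x + p j) + (sv (x + p j) A + w i / (x + p j + a + p i))))
  = D + (l2 * sv x A + l3 * sv (x + p i) A - (l2 + l3) * sv (x + p j) A) by lra.
rewrite /D /g /delta /l2 /l3 /s; field.
by rewrite ?gt_eqF //=; lra.
Qed.

(* Here [i A j] and [i j A] are mixed, with weights [l3] and [l1]. The sign of
   [delta] is only needed at [x + dur A], that is [p j] before the start of [i]:
   this is what excludes the whole interval [[t*, t* + p_j)]. *)
Lemma exchange_short x A i j : 0 <= x -> p i < p j ->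
  0 < delta i j (x + dur A) ->
  exists2 B, perm_eq B (j :: A ++ [:: i]) & sv x (j :: A ++ [:: i]) < sv x B.
Proof.
pose a := dur A; have a0 : 0 <= a := dur_ge0 A; rewrite -/a.
move=> x0 lt_ij d0.
have := hp i; have := hp j; have := hw i; have := hw j => wj wi pj pi.
(* These weights make the termwise comparison tight at [z = x + a]. *)
pose l3 := p i * (x + a + p i); pose l1 := (p j - p i) * (x + a + p j + p i).
have l10 : 0 <= l1 by rewrite mulr_ge0 //; lra.
have l30 : 0 <= l3 by rewrite mulr_ge0 //; lra.
have hA : (l3 + l1) * sv (x + p j) A <= l3 * sv (x + p i) A + l1 * sv (x + (p i + p j)) A.
  apply: sched_value_mix => z z1 z2; rewrite -/a in z2.
  rewrite -subr_ge0.
  have -> : l3 / (z + p i) + l1 / (z + (p i + p j)) - (l3 + l1) / (z + p j) =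
    (p j - p i) * p i * p j * (x + a - z) / ((z + p i) * (z + p i + p j) * (z + p j)).
    by rewrite /l1 /l3; field; rewrite ?gt_eqF //=; lra.
  by rewrite divr_ge0 // !mulr_ge0 //; lra.
have [] := @mix_gt l3 l1 (sv x (j :: A ++ [:: i])) (sv x (i :: A ++ [:: j]))
  (sv x (i :: j :: A)) l30 l10; last first.
- exists (i :: j :: A) => //.
  by apply/permP => u; rewrite /= count_cat /= addn0 addnC addnA.
- exists (i :: A ++ [:: j]) => //.
  exact: perm_swap_ends.
rewrite /= !sched_value_cat /= -/a !addr0.
pose s := x + a + p j.
pose g := (l1 + l3) * (a + p j) / ((x + p i) * (s + p i)).
have g0 : 0 < g.
  by rewrite divr_gt0 // !mulr_gt0 ?ltr_wpDl ?mulr_gt0 // /s; lra.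
(* Again the gain of [i] and [j] alone. The [delta] term is strictly positive by hypothesis, so the
   remainder need only be nonnegative. *)
pose D := delta i j (x + a) * g / (p j * s) +
  w j * (p i * a * (p j - p i) * ((a + p j) / (x + p i) - a / (x + p i + p j)))
    / ((x + p j) * (s + p i)).
have D0 : 0 < D.
  rewrite ltr_pwDl //.
    by rewrite divr_gt0 // mulr_gt0 // /s; lra.
  have -> : (a + p j) / (x + p i) - a / (x + p i + p j) =
    (a * p j + p j * (x + p i + p j)) / ((x + p i) * (x + p i + p j)).
    by field; rewrite ?gt_eqF //=; lra.
  have h : 0 <= a * p j + p j * (x + p i + p j) by rewrite addr_ge0 // mulr_ge0 //; lra.
  by rewrite !mulr_ge0 // ?invr_ge0 ?mulr_ge0 // /s; lra.
rewrite addrA in hA.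
suff : l3 * (w i / (x + p i) + (sv (x + p i) A + w j / (x + p i + a + p j)) -
   (w j / (x + p j) + (sv (x + p j) A + w i / (x + p j + a + p i)))) +
  l1 * (w i / (x + p i) + (w j / (x + p i + p j) + sv (x + p i + p j) A) -
   (w j / (x + p j) + (sv (x + p j) A + w i / (x + p j + a + p i))))
  = D + (l3 * sv (x + p i) A + l1 * sv (x + p i + p j) A - (l3 + l1) * sv (x + p j) A) by lra.
rewrite /D /g /delta /l1 /l3 /s; field.
by rewrite ?gt_eqF //=; lra.
Qed.

(** * Slope of the comparison and adjacent swaps *)

(** At a zero, [w i * p j / (w j * p i)] equals [(p i + x) / (p j + x) > 1]: at a crossing it is the
    longer job that takes over. *)
Lemma delta_slope_gt0 i j x : 0 <= x -> p j < p i -> delta i j x = 0 ->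
  0 < w i * p j - w j * p i.
Proof.
move=> x0 lt_ji d0; move: (hp i) (hp j) (hw j) => pi pj wj.
have pjx : 0 < p j + x by lra.
rewrite -(pmulr_lgt0 _ pjx).
have -> : (w i * p j - w j * p i) * (p j + x) =
  delta i j x + w j * p i * (p i - p j) by rewrite /delta; ring.
by rewrite d0 add0r !mulr_gt0 // subr_gt0.
Qed.

Lemma delta_shift i j x y :
  delta i j y = delta i j x + (w i * p j - w j * p i) * (y - x).
Proof. by rewrite /delta; ring. Qed.

Lemma sched_value_swap x i j : 0 <= x -> 0 <= delta i j x ->
  sv x [:: j; i] <= sv x [:: i; j].
Proof.
move=> x0 d; move: (hp i) (hp j) => pi pj.
rewrite -subr_ge0 /=.
have -> : w i / (x + p i) + (w j / (x + p i + p j) + 0) -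
   (w j / (x + p j) + (w i / (x + p j + p i) + 0)) =
  delta i j x / ((x + p i) * (x + p j) * (x + p i + p j)).
  by rewrite /delta; field; rewrite ?gt_eqF //=; lra.
by rewrite divr_ge0 // !mulr_ge0 //; lra.
Qed.

Lemma sched_value_identical x A i j : p i = p j -> w i = w j ->
  sv x (i :: A ++ [:: j]) = sv x (j :: A ++ [:: i]).
Proof. by move=> ep ew; rewrite /= !sched_value_cat /= ep ew. Qed.

(** * Optimal schedules of a job set *)

Lemma seq_arg_max d (O : orderType d) (U : eqType) (f : U -> O) (s : seq U) :
  s != [::] -> exists2 x, x \in s & forall y, y \in s -> (f y <= f x)%O.
Proof.
elim: s => // x [|z s] IH _.
  by exists x; rewrite ?mem_head // => y; rewrite inE => /eqP->.
have [//|m ms hm] := IH.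
case: (leP (f x) (f m)) => h.
  exists m; first by rewrite inE ms orbT.
  by move=> y; rewrite inE => /orP[/eqP->//|/hm].
exists x; first by rewrite mem_head.
move=> y; rewrite inE => /orP[/eqP->//|/hm hy].
exact: le_trans hy (ltW h).
Qed.

(** An explicit finite list, so that optimality is decidable and an extremal optimal schedule can be
    picked by [seq_arg_max]. *)
Definition schedules (J : {set T}) : seq (seq T) := permutations (enum J).

Definition optimal (J : {set T}) (t : R) (s : seq T) : bool :=
  (s \in schedules J) && all (fun s' => sv t s' <= sv t s) (schedules J).

Lemma optimalP (J : {set T}) t s : reflect
  (perm_eq s (enum J) /\ forall s', perm_eq s' (enum J) -> sv t s' <= sv t s)
  (optimal J t s).
Proof.
rewrite /optimal /schedules mem_permutations; apply: (iffP andP) => -[h1].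
  by move=> /allP h2; split=> // s' hs'; apply: h2; rewrite mem_permutations.
by move=> h2; split=> //; apply/allP => s'; rewrite mem_permutations => /h2.
Qed.

Lemma optimal_exists (J : {set T}) t : exists s, optimal J t s.
Proof.
have [|s s1 s2] := @seq_arg_max _ _ _ (sv t) (schedules J).
  by apply/eqP => h; move: (perm_refl (enum J)); rewrite -mem_permutations -/(schedules J) h.
by exists s; rewrite /optimal s1; apply/allP.
Qed.

Lemma optimal_local J t L M N B : optimal J t (L ++ M ++ N) -> perm_eq B M ->
  sv (t + dur L) B <= sv (t + dur L) M.
Proof.
move=> /optimalP[hs opt] hB.
have /opt : perm_eq (L ++ B ++ N) (enum J).
  by apply: perm_trans hs; rewrite perm_cat2l perm_cat2r.
rewrite !sched_value_cat (perm_dur _ _ hB); lra.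
Qed.

Lemma optimal_exchange J t L M N B : optimal J t (L ++ M ++ N) -> perm_eq B M ->
  sv (t + dur L) M <= sv (t + dur L) B -> optimal J t (L ++ B ++ N).
Proof.
move=> /optimalP[hs opt] hB hle; apply/optimalP; split.
  by apply: perm_trans hs; rewrite perm_cat2l perm_cat2r.
move=> s' /opt; rewrite !sched_value_cat (perm_dur _ _ hB); lra.
Qed.

Lemma tend_dur (J : {set T}) t s : perm_eq s (enum J) -> tend J t = t + dur s.
Proof. by move=> h; rewrite /t_end (perm_dur _ _ h) /dur big_enum. Qed.

(** * The place of [alpha] in an optimal schedule of a subproblem *)

Section Subproblem.

Variables (J : {set T}) (t : R) (a : T).
Hypotheses (t_ge0 : 0 <= t) (a_spec : alpha_spec p w J t a).

Local Notation te := (tend J t).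

(* The jobs that [alpha] precedes if it starts before [t*], and that it follows if
   it starts after [t* + p_j]; [alpha] beats all other jobs throughout. *)
Definition crosses (j : T) : bool := tdef a j && (t < tstar a j < te).

Lemma lt_tend : t < te.
Proof.
rewrite (tend_dur _ _ _ (perm_refl _)) ltrDl dur_gt0 //.
case: a_spec => aJ _; apply/eqP => e.
by have := mem_enum J a; rewrite e aJ.
Qed.

Lemma alpha_delta_ge0 j : j \in J -> 0 <= delta a j t.
Proof. by move=> jJ; case: a_spec => _ /(_ j jJ)[]; rewrite phi_leE. Qed.

(** The tie-breaking rule for [alpha]: a job tied with it at [t] does not overtake it before
    [te]. *)
Lemma alpha_tie j : j \in J -> delta a j t = 0 -> 0 <= delta a j te.
Proof.
move=> jJ d0; case: a_spec => _ /(_ j jJ)[_].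
rewrite phi_leE; last exact: le_trans t_ge0 (ltW lt_tend).
by apply; apply/eqP; rewrite phi_eqE // d0.
Qed.

Lemma crosses_slope j : j \in J -> crosses j -> w a * p j - w j * p a < 0.
Proof.
move=> jJ /andP[d /andP[h1 _]]; have := alpha_delta_ge0 _ jJ.
have d' : w a * p j - w j * p a != 0 by rewrite subr_eq0.
have ts : t - tstar a j < 0 by lra.
rewrite delta_tstar // nmulr_lge0 // => h.
by rewrite lt_neqAle d'.
Qed.

(** By [crosses_slope], [delta a j] has negative slope. A longer [a] would give positive slope at
    the zero [t*]; for equal lengths [delta] is its slope times a positive factor, so a zero would
    make the slope vanish. *)
Lemma crosses_longer j : j \in J -> crosses j -> p a < p j.
Proof.
move=> jJ c; have k := crosses_slope _ jJ c.
rewrite ltNge; apply/negP => le_ja.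
case/andP: c => d /andP[h1 _].
have := delta_tstar _ _ (tstar a j) d; rewrite subrr mulr0 => z.
move: le_ja; rewrite le_eqVlt => /orP[/eqP e|lt_ja].
  move: z k; rewrite /delta e => z.
  have : (w a * p a - w j * p a) * (p a + tstar a j) = 0 by rewrite -[RHS]z; ring.
  move/eqP; rewrite mulf_eq0 => /orP[/eqP->|/eqP]; first by rewrite ltxx.
  by move: (hp a) t_ge0; lra.
have t0 : 0 <= tstar a j by move: t_ge0; lra.
by have := delta_slope_gt0 _ _ _ t0 lt_ja z; lra.
Qed.

Lemma crosses_delta_gt0 j u : j \in J -> crosses j -> u < tstar a j ->
  0 < delta a j u.
Proof.
move=> jJ c h; have k := crosses_slope _ jJ c; case/andP: c => d _.
by rewrite delta_tstar // nmulr_lgt0 // subr_lt0.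
Qed.

Lemma crosses_delta_lt0 j u : j \in J -> crosses j -> tstar a j < u ->
  delta a j u < 0.
Proof.
move=> jJ c h; have k := crosses_slope _ jJ c; case/andP: c => d _.
by rewrite delta_tstar // nmulr_rlt0 // subr_gt0.
Qed.

(** An affine function that is nonnegative at [t] and has no zero inside [(t, te)] stays
    nonnegative, unless it vanishes at [t] with negative slope; [alpha_tie] excludes that case. *)
Lemma not_crosses_delta j u : j \in J -> ~~ crosses j -> t <= u <= te ->
  0 <= delta a j u.
Proof.
move=> jJ nc /andP[u1 u2]; have d0 := alpha_delta_ge0 _ jJ.
have lt_te := lt_tend.
have [d|/negP d] := boolP (tdef a j); last first.
  have e : w a * p j - w j * p a = 0.
    by apply/eqP; rewrite subr_eq0; apply/negPn/negP.
  by rewrite (delta_shift _ _ t) e mul0r addr0.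
move: d0 (alpha_tie _ jJ); rewrite !delta_tstar //.
set k := _ - _; set ts := tstar a j => d0 tie.
have [k0|k0] := leP 0 k.
  have [le_ts|lt_ts] := leP ts t; first by rewrite mulr_ge0 //; lra.
  have k1 : k != 0 by rewrite subr_eq0.
  have : 0 < k by rewrite lt_neqAle eq_sym k1.
  by move=> kp; rewrite pmulr_rge0 // in d0; lra.
have tts : t <= ts by rewrite nmulr_rge0 ?subr_le0 in d0.
have : ts = t \/ t < ts by move: tts; rewrite le_eqVlt => /orP[/eqP|]; auto.
case=> [e|lt_ts].
  have := tie; rewrite e subrr mulr0 => /(_ erefl).
  by rewrite nmulr_rge0 //; lra.
have : te <= ts by move: nc; rewrite /crosses d lt_ts /= -leNgt.
by move=> h; rewrite nmulr_rge0 //; lra.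
Qed.

Lemma split_schedule s : perm_eq s (enum J) ->
  exists L N, [/\ s = L ++ a :: N, a \notin L & a \notin N].
Proof.
move=> hs; case: a_spec => aJ _.
have: a \in s by rewrite (perm_mem hs) mem_enum.
have: uniq s by rewrite (perm_uniq hs) enum_uniq.
move=> + h; case/splitPr: h => L N.
rewrite cat_uniq /= => /and3P[_ h /andP[aN _]].
by exists L, N; split => //; case/norP: h.
Qed.

(** For these jobs [delta a j] is identically zero, so no strict exchange places them relative to
    [alpha]. *)
Definition identical (j : T) : bool := (p j == p a) && (w j == w a).

Definition before_alpha (s : seq T) : seq T := take (index a s) s.

Lemma index_alpha L N : a \notin L -> index a (L ++ a :: N) = size L.
Proof. by move=> h; rewrite index_cat (negbTE h) /= eqxx addn0. Qed.

Lemma before_alphaE L N : a \notin L -> before_alpha (L ++ a :: N) = L.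
Proof. by move=> h; rewrite /before_alpha index_alpha // take_size_cat. Qed.

(** Take an optimal schedule with [a] as early as possible: exchanging [a] with an identical job
    before it would keep the value and put [a] earlier. *)
Lemma optimal_no_identical_before :
  exists2 s, optimal J t s & ~~ has identical (before_alpha s).
Proof.
have [s0 /andP[hs0 o0]] := optimal_exists J t.
pose S := [seq s <- schedules J | optimal J t s].
have S0 : S != [::].
  by rewrite -has_filter; apply/hasP; exists s0 => //; rewrite /optimal hs0.
(* All schedules have length [size s0], so maximizing this difference minimizes the position of
   [a]. *)
have [s hs hmin] := @seq_arg_max _ _ _ (fun s : seq T => size s0 - index a s)%N S S0.
move: hs; rewrite mem_filter => /andP[os _]; exists s => //.
have szS s' : optimal J t s' -> size s' = size s0.
  move=> /andP[h _]; move: h hs0; rewrite !mem_permutations => h1 h2.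
  by rewrite (perm_size h1) (perm_size h2).
have hmin' s' : optimal J t s' -> (index a s <= index a s')%N.
  move=> o'; have := hmin s'; rewrite mem_filter o' /=.
  case/andP: (o') => -> _ => /(_ isT).
  rewrite leEnat -(szS _ os) => h.
  have : (index a s <= size s)%N by rewrite index_size.
  have := index_size a s'; rewrite (szS _ o') -(szS _ os).
  move: h; set x := index a s; set y := index a s'; set z := size s.
  by move=> h1 h2 h3; rewrite -(leq_sub2lE _ h3).
have [hs _] := optimalP _ _ _ os.
have [L [N [es aL aN]]] := split_schedule _ hs.
rewrite es before_alphaE //; apply/negP => /hasP[j jL /andP[/eqP ep /eqP ew]].
case/splitPr: jL => L1 A in es aL *.
have es' : s = L1 ++ (j :: A ++ [:: a]) ++ N by rewrite es -!catA /= -catA.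
rewrite es' in os.
have o' := optimal_exchange _ _ _ _ _ _ os (perm_swap_ends a j A).
rewrite (sched_value_identical _ _ _ _ ep ew) in o'.
have {o'} /hmin' := o' (lexx _).
rewrite es /= index_alpha // index_alpha; last first.
  by move: aL; rewrite mem_cat => /norP[].
by rewrite size_cat /= leqNgt addnS ltnS leq_addr.
Qed.

Lemma no_better_block L M N : optimal J t (L ++ M ++ N) ->
  ~ (exists2 B, perm_eq B M & sv (t + dur L) M < sv (t + dur L) B).
Proof.
by move=> o [B hB]; rewrite ltNge (optimal_local _ _ _ _ _ _ o hB).
Qed.

(* Ties: exchanging [alpha] with an identical job or with a first job tied at [t]
   moves it forward, and exchanging it with a job [j] at [t*_{alpha j}] moves it
   backward. So either some optimal schedule starts with [alpha], or one takes the
   last possible position of [alpha] among the optimal schedules with no identical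
   job before it. *)
Lemma good_schedule : exists L N,
  [/\ optimal J t (L ++ a :: N),
      forall j, j \in L -> crosses j && (tstar a j + p j <= t + dur L) &
      forall j, j \in N -> crosses j -> t + dur L < tstar a j].
Proof.
have [/hasP[s _ /andP[os /eqP hd]]|nfirst] :=
  boolP (has (fun s => optimal J t s && (ohead s == Some a)) (schedules J)).
  case: s os hd => // b N os [eb]; subst b; exists [::], N; split => //.
  by move=> j _ /andP[_ /andP[h _]]; rewrite dur_nil addr0.
have {}nfirst N : ~ optimal J t (a :: N).
  move=> o; move/hasPn: nfirst => /(_ (a :: N)); rewrite o /= eqxx.
  by case/andP: o => -> _ /(_ isT).
pose S := [seq s <- schedules J | optimal J t s & ~~ has identical (before_alpha s)].
have memS s : optimal J t s -> ~~ has identical (before_alpha s) -> s \in S.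
  by move=> o h; rewrite mem_filter o h; case/andP: o.
have [s0 o0 h0] := optimal_no_identical_before.
have S0 : S != [::] by apply/eqP => e; have := memS _ o0 h0; rewrite e.
have [s hs hmax] := @seq_arg_max _ _ _ (index a) S S0.
move: hs; rewrite mem_filter => /andP[/andP[os nid] _].
have [hs _] := optimalP _ _ _ os.
have [L [N [es aL aN]]] := split_schedule _ hs.
have eJ j : j \in L ++ a :: N -> j \in J.
  by rewrite -es (perm_mem hs) mem_enum.
have dtot : te = t + dur L + p a + dur N.
  by rewrite (tend_dur _ _ _ hs) es dur_cat dur_cons !addrA.
have dN0 := dur_ge0 N; have pa := hp a; have t0 := t_ge0.
rewrite es before_alphaE // in nid; exists L, N; rewrite -es; split => // j jX.
- have jJ : j \in J by rewrite eJ // mem_cat jX.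
  have nidj : ~~ identical j by apply: contra nid => h; apply/hasP; exists j.
  have pj := hp j.
  case/splitPr: jX => L1 A in es aL nid eJ dtot *.
  have {}es : s = L1 ++ (j :: A ++ [:: a]) ++ N by rewrite es -!catA /= -catA.
  rewrite es in os; have nb := no_better_block _ _ _ os.
  move: dtot; rewrite dur_cat dur_cons => dtot.
  have d1 := dur_ge0 L1; have dA := dur_ge0 A.
  pose x := t + dur L1; have x0 : 0 <= x by rewrite /x; lra.
  have [c|nc] := boolP (crosses j).
    (* As [a] starts at [t + dur L], the time [x + dur A] is [p j] earlier, hence before [t*]. *)
    rewrite /= leNgt; apply/negP => lt_s; apply: nb; apply: exchange_short => //.
      exact: crosses_longer.
    by apply: crosses_delta_gt0 => //; lra.
  have dge u : t <= u <= te -> 0 <= delta a j u by apply: not_crosses_delta.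
  exfalso; have [le_ja|lt_aj] := leP (p j) (p a); last first.
    apply: nb; apply: exchange_short => //.
    set u := t + _ + _; have u0 : 0 <= u by rewrite /u; lra.
    rewrite lt_neqAle dge ?andbT; last by rewrite /u; apply/andP; split; lra.
    (* A zero at [u] would give [delta a j] negative slope, [j] being the longer job, and so a
       negative value at [te]. *)
    apply/eqP => /esym z; have z' : delta j a u = 0 by rewrite deltaC z oppr0.
    have k := delta_slope_gt0 _ _ _ u0 lt_aj z'.
    have : 0 <= delta a j te by apply: dge; rewrite lexx andbT ltW ?lt_tend.
    rewrite leNgt (delta_shift _ _ u) z add0r nmulr_rlt0 ?subr_gt0; first by rewrite /u; lra.
    by move: k; rewrite subr_gt0 => k; rewrite subr_lt0.
  have dx : 0 <= delta a j x by apply: dge; apply/andP; split; rewrite /x; lra.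
  move: (dx); rewrite le_eqVlt => /orP[/eqP/esym z|dx1]; last first.
    by apply: nb; apply: exchange_long => //; rewrite dx1.
  move: (le_ja); rewrite le_eqVlt => /orP[/eqP e|lt_ja].
    case/negP: nidj; rewrite /identical e eqxx /=.
    have : (w a - w j) * (p a * (p a + x)) = 0 by rewrite -[RHS]z /delta e; ring.
    move/eqP; rewrite mulf_eq0 subr_eq0 eq_sym => /orP[//|].
    by rewrite gt_eqF // mulr_gt0 //; lra.
  have [eA|nA] := eqVneq A [::]; last first.
    by apply: nb; apply: exchange_long => //; rewrite lt_ja nA orbT.
  (* If [L1] is nonempty then [x > t], and a zero at [x] with positive slope makes [delta a j]
     negative at [t]. If it is empty, [j] and [a] open the schedule and swapping them puts [a]
     first, a case already excluded. *)
  have [eL|nL] := eqVneq L1 [::]; last first.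
    have k := delta_slope_gt0 _ _ _ x0 lt_ja z.
    have := alpha_delta_ge0 _ jJ; rewrite leNgt (delta_shift _ _ x) z add0r.
    by rewrite pmulr_rlt0 // /x; move: (dur_gt0 _ nL); lra.
  subst A L1; apply: (nfirst (j :: N)).
  have := optimal_exchange J t [::] [:: j; a] N [:: a; j] os.
  apply; first exact: (perm_swap_ends a j [::]).
  by apply: sched_value_swap => //; rewrite /= dur_nil addr0 ?alpha_delta_ge0.
- move=> c; have jJ : j \in J by rewrite eJ // mem_cat inE jX !orbT.
  have lt_aj := crosses_longer _ jJ c.
  rewrite ltNge; apply/negP => le_ts.
  case/splitPr: jX => A N2 in es aN eJ dtot dN0 *.
  have {}es : s = L ++ (a :: A ++ [:: j]) ++ N2 by rewrite es /= -catA.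
  rewrite es in os; have nb := no_better_block _ _ _ os.
  have dL := dur_ge0 L.
  pose x := t + dur L; have x0 : 0 <= x by rewrite /x; lra.
  have dx : delta j a x = - (w a * p j - w j * p a) * (x - tstar a j).
    by rewrite deltaC delta_tstar ?mulNr //; case/andP: c.
  have k := crosses_slope _ jJ c.
  have dx0 : 0 <= delta j a x by rewrite dx mulr_ge0 // /x; lra.
  move: (dx0); rewrite le_eqVlt => /orP[/eqP/esym z|dx1]; last first.
    by apply: nb; apply: exchange_long => //; rewrite ?dx1 ?ltW.
  have [eA|nA] := eqVneq A [::]; last first.
    by apply: nb; apply: exchange_long => //; rewrite ?lt_aj ?nA ?orbT ?ltW.
  subst A; have os' := optimal_exchange J t L [:: a; j] N2 [:: j; a] os.
  have {}os' : optimal J t (rcons L j ++ a :: N2).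
    rewrite cat_rcons; apply: os'; first exact: (perm_swap_ends j a [::]).
    exact: sched_value_swap.
  have aL' : a \notin rcons L j.
    by rewrite mem_rcons inE negb_or aL andbT; apply: contraTneq lt_aj => ->; rewrite ltxx.
  (* At the tie, moving [j] ahead of [a] costs nothing and pushes [a] one place back, against
     maximality; [j] is longer than [a], hence not identical to it. *)
  have /hmax : rcons L j ++ a :: N2 \in S.
    apply: memS => //; rewrite before_alphaE // has_rcons negb_or nid andbT.
    by rewrite /identical gt_eqF.
  by rewrite es leEnat !index_alpha // size_rcons ltnn.
Qed.

End Subproblem.

(** * Banned start times *)

Lemma delta_trans i j k t : 0 <= t -> 0 <= delta i j t -> 0 <= delta j k t ->
  0 <= delta i k t.
Proof. by move=> t0; rewrite -!phi_leE // => h1 h2; apply: le_trans h2 h1. Qed.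

Definition bans (i j : T) (s : R) : bool :=
  [&& phi j 0 < phi i 0, tdef i j, 0 < tstar i j & tstar i j <= s < tstar i j + p j].

(** [delta i j] is positive at 0 and vanishes at [t* > 0]. *)
Lemma bans_slope i j s : bans i j s -> w i * p j - w j * p i < 0.
Proof.
move=> /and4P[h d ts _]; move: h; rewrite phi_ltE // delta_tstar // sub0r mulrN.
by rewrite oppr_gt0 pmulr_llt0.
Qed.

Lemma bans_delta_gt0 i j s u : bans i j s -> u < tstar i j -> 0 < delta i j u.
Proof.
move=> b h; have k := bans_slope _ _ _ b; case/and4P: b => _ d _ _.
by rewrite delta_tstar // nmulr_rgt0 // subr_lt0.
Qed.

Lemma bans_delta_lt0 i j s u : bans i j s -> tstar i j < u -> delta i j u < 0.
Proof.
move=> b h; have k := bans_slope _ _ _ b; case/and4P: b => _ d _ _.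
by rewrite delta_tstar // nmulr_rlt0 // subr_gt0.
Qed.

Lemma in_banned_bans i s : in_banned p w i s -> exists2 j, j != i & bans i j s.
Proof.
case/existsP => j /and5P[ji h1 h2 /andP[h3 _] h4].
by exists j => //; rewrite /bans h1 h2 h3 h4.
Qed.

(** Past [t*] the job [j] beats [a], so [t* < t] contradicts the choice of [a] at [t], and [t* = t]
    its tie-breaking rule. *)
Lemma bans_crosses J t a j s : 0 <= t -> alpha_spec p w J t a -> j \in J ->
  s < tend J t -> bans a j s -> crosses J t a j.
Proof.
move=> t0 ha jJ s1 b; have [_ d _ /andP[h1 _]] := and4P b.
rewrite /crosses d (le_lt_trans h1 s1) andbT /=.
have : t <= tstar a j.
  rewrite leNgt; apply/negP => /(bans_delta_lt0 _ _ _ _ b).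
  by rewrite ltNge (alpha_delta_ge0 _ _ _ t0 ha).
rewrite le_eqVlt => /orP[/eqP e|//]; exfalso.
have /(alpha_tie _ _ _ t0 ha _ jJ) : delta a j t = 0.
  by rewrite delta_tstar // -e subrr mulr0.
rewrite leNgt (bans_delta_lt0 _ _ _ _ b) // -e.
exact: lt_tend ha.
Qed.

Lemma optimal_set0 t : optimal set0 t [::].
Proof.
apply/optimalP; rewrite enum_set0; split => // s /perm_nilP -> //.
Qed.

Lemma optimal_set1 j t : optimal [set j] t [:: j].
Proof.
apply/optimalP; rewrite enum_set1; split => // s hs.
by rewrite (perm_small_eq _ hs).
Qed.

(** * Breakpoints and the two parts of a cut *)

Variable sel : {set T} -> R -> T.
Hypothesis hsel : forall (J : {set T}) (t : R), J != set0 ->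
  alpha_spec p w J t (sel J t).

Lemma sorted_cpoints (J : {set T}) t : sorted <=%R (cpoints p w sel J t).
Proof. exact: sort_le_sorted. Qed.

Lemma start_in_cpoints (J : {set T}) t : t \in cpoints p w sel J t.
Proof. by rewrite mem_sort mem_undup mem_head. Qed.

Lemma end_in_cpoints (J : {set T}) t : tend J t \in cpoints p w sel J t.
Proof. by rewrite mem_sort mem_undup !inE eqxx orbT. Qed.

Lemma cval_in_cpoints (J : {set T}) t j : j \in J -> j != sel J t ->
  tdef (sel J t) j -> t < cval p w (sel J t) j < tend J t ->
  cval p w (sel J t) j \in cpoints p w sel J t.
Proof.
move=> jJ ja d h; rewrite mem_sort mem_undup !inE; apply/orP; right.
apply/orP; right; apply: (map_f (cval p w (sel J t))).
by rewrite mem_filter ja d h mem_enum.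
Qed.

Lemma cpoints_le_end (J : {set T}) t c : J != set0 -> c \in cpoints p w sel J t ->
  c <= tend J t.
Proof.
move=> J0; rewrite mem_sort mem_undup !inE => /or3P[/eqP->|/eqP->//|].
  exact/ltW/lt_tend/hsel.
case/mapP => j; rewrite mem_filter => /andP[/and3P[_ _ /andP[_ h]] _] ->.
exact: ltW.
Qed.

(** Thus every [q] below the number of points is at most [#|J|], and the default value [#|J|.+1] of
    [Mfun] exceeds it. *)
Lemma size_cpoints (J : {set T}) t : J != set0 ->
  (size (cpoints p w sel J t) <= #|J|.+1)%N.
Proof.
move=> J0; rewrite size_sort; apply: leq_trans (size_undup _) _.
rewrite /= size_map ltnS cardE; set s := [seq j <- enum J | _].
have [aJ _] := hsel J t J0.
have : uniq (sel J t :: s).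
  rewrite /= mem_filter eqxx /=; exact/filter_uniq/enum_uniq.
move=> /uniq_leq_size; apply => j; rewrite inE mem_filter mem_enum.
by case/orP => [/eqP->//|/andP[]].
Qed.

Lemma nth_cpoints_le (J : {set T}) t m n :
  (m <= n < size (cpoints p w sel J t))%N ->
  nth 0 (cpoints p w sel J t) m <= nth 0 (cpoints p w sel J t) n.
Proof.
move=> /andP[mn nS]; apply: (sorted_leq_nth le_trans le_refl) => //.
- exact: sorted_cpoints.
- by rewrite inE (leq_ltn_trans mn nS).
Qed.

Lemma cpoints_bracket (J : {set T}) t s : J != set0 -> t <= s < tend J t ->
  exists q, [/\ (0 < q < size (cpoints p w sel J t))%N,
    cpt p w sel J t q <= s & s < cpt p w sel J t q.+1].
Proof.
move=> J0 /andP[ts se]; pose cs := cpoints p w sel J t.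
have hcs : has (fun c => s < c) cs.
  by apply/hasP; exists (tend J t) => //; apply: end_in_cpoints.
(* The 0-based index of the first point beyond [s] is the 1-based index of the point preceding
   it. *)
exists (find (fun c => s < c) cs); rewrite -has_find hcs andbT.
set q := find _ _.
have h2 : s < nth 0 cs q := nth_find 0 hcs.
have qS : (q < size cs)%N by rewrite -has_find.
have q0 : (0 < q)%N.
  rewrite lt0n; apply/eqP => q0; move: h2; rewrite q0 ltNge => /negP; apply.
  apply: le_trans ts; rewrite -[leRHS](nth_index 0 (start_in_cpoints J t)).
  by apply: nth_cpoints_le; rewrite index_mem start_in_cpoints.
split => //; rewrite /cpt -/cs leNgt.
have lt : (q.-1 < q)%N by rewrite prednK.
by rewrite (before_find 0 lt).
Qed.

(** The points are sorted and [s] lies between the [q]-th and the next, so comparing indices with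
    [q] is comparing points with [s]. *)
Lemma Mfun_leE (J : {set T}) t q s j : J != set0 -> j \in J -> j != sel J t ->
  (0 < q < size (cpoints p w sel J t))%N ->
  cpt p w sel J t q <= s -> s < cpt p w sel J t q.+1 ->
  (Mfun p w sel J t j <= q)%N =
  crosses J t (sel J t) j && (tstar (sel J t) j + p j <= s).
Proof.
move=> J0 jJ ja /andP[q0 qS]; rewrite /cpt /= => h1 h2.
rewrite /Mfun (negbTE ja) andbA -/(crosses J t (sel J t) j).
have qJ : (#|J| < q)%N = false.
  apply: negbTE; rewrite -leqNgt -ltnS.
  exact: leq_trans qS (size_cpoints _ _ J0).
have [c|_] /= := boolP (crosses _ _ _ _); last exact: qJ.
rewrite -/(cval p w (sel J t) j); set c' := cval _ _ _ _.
have [c'in|c'out] := boolP (c' \in _).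
  have iS : (index c' (cpoints p w sel J t) < size (cpoints p w sel J t))%N.
    by rewrite index_mem.
  have e := nth_index 0 c'in.
  have [lt|ge] := ltnP (index c' (cpoints p w sel J t)) q.
    apply/esym; apply: le_trans h1; rewrite -[leLHS]e.
    by apply: nth_cpoints_le; rewrite -ltnS prednK // lt ltnW.
  apply/esym/negbTE; rewrite -ltNge; apply: lt_le_trans h2 _.
  by rewrite -[leRHS]e; apply: nth_cpoints_le; rewrite ge.
rewrite qJ; apply/esym/negbTE; rewrite -ltNge.
(* A crossing job has [t* > t], so its point exceeds [t] and is missing from the list only if it is
   not below [tend J t]. *)
have : tend J t <= c'.
  rewrite leNgt; apply/negP => lt; case/negP: c'out.
  case/andP: c => d /andP[lts _].
  apply: cval_in_cpoints => //; rewrite lt andbT /cval.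
  by move: (hp j); lra.
apply: lt_le_trans; apply: lt_le_trans h2 _; apply: cpoints_le_end => //.
exact: mem_nth.
Qed.

Lemma mem_Jl (J : {set T}) t q s j : J != set0 ->
  (0 < q < size (cpoints p w sel J t))%N ->
  cpt p w sel J t q <= s -> s < cpt p w sel J t q.+1 ->
  (j \in Jl p w sel J t q) =
  [&& j \in J, j != sel J t, crosses J t (sel J t) j & tstar (sel J t) j + p j <= s].
Proof.
move=> J0 hq h1 h2; rewrite inE.
have [jJ|//] /= := boolP (j \in J); have [//|ja] /= := eqVneq j (sel J t).
exact: Mfun_leE.
Qed.

Lemma mem_Jr (J : {set T}) t q j : (0 < q)%N ->
  (j \in Jr p w sel J t q) =
  [&& j \in J, j != sel J t & j \notin Jl p w sel J t q].
Proof.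
move=> q0; rewrite !inE; have [jJ|//] /= := boolP (j \in J).
have [->|ja] /= := eqVneq j (sel J t); last by rewrite ltnNge.
(* [Mfun] is 1 at [alpha], so [0 < q] keeps it out of [Jr]. *)
by rewrite /Mfun eqxx ltnNge q0.
Qed.

(* [in_banned] quantifies over all jobs; this is the invariant of the recursion
   that makes the bans due to jobs outside [J] harmless. *)
Definition unbanned_outside (J : {set T}) (t : R) : Prop :=
  forall i j s, i \in J -> j \notin J -> t <= s < tend J t -> ~~ bans i j s.

Definition valid_cut (J : {set T}) (t : R) (q : nat) : bool :=
  (0 < q < size (cpoints p w sel J t))%N &&
  [&& cpt p w sel J t q <= sq p w sel J t q,
      sq p w sel J t q < cpt p w sel J t q.+1
    & ~~ in_banned p w (sel J t) (sq p w sel J t q)].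

Lemma perm_glue (J : {set T}) t q sl sr : J != set0 -> (0 < q)%N ->
  perm_eq sl (enum (Jl p w sel J t q)) -> perm_eq sr (enum (Jr p w sel J t q)) ->
  perm_eq (sl ++ sel J t :: sr) (enum J).
Proof.
move=> J0 q0 hl hr; have [aJ _] := hsel J t J0.
have ml j : (j \in sl) = (j \in Jl p w sel J t q) by rewrite (perm_mem hl) mem_enum.
have mr j : (j \in sr) = (j \in Jr p w sel J t q) by rewrite (perm_mem hr) mem_enum.
apply: uniq_perm; rewrite ?enum_uniq //.
  rewrite cat_uniq /= (perm_uniq hl) (perm_uniq hr) !enum_uniq /= !andbT negb_or.
  rewrite ml mr mem_Jr // eqxx andbF andbT !inE eqxx andbF /=.
  by apply/hasPn => j; rewrite mr mem_Jr // => /and3P[_ _]; rewrite /= ml.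
move=> j; rewrite mem_enum mem_cat inE ml mr mem_Jr //.
have [->|ja] /= := eqVneq j (sel J t); first by rewrite aJ orbT.
have [jl|_] /= := boolP (j \in Jl _ _ _ _ _ _); last by rewrite andbT.
by move: jl; rewrite inE => /andP[->].
Qed.

Lemma sum_glue (J : {set T}) t q : J != set0 -> (0 < q)%N ->
  tend (Jr p w sel J t q) (sq p w sel J t q + p (sel J t)) = tend J t.
Proof.
move=> J0 q0; have h := perm_glue J t q _ _ J0 q0 (perm_refl _) (perm_refl _).
rewrite (tend_dur _ _ _ h) dur_cat dur_cons (tend_dur _ _ _ (perm_refl _)).
by rewrite /sq /dur !big_enum /= !addrA.
Qed.

Lemma sq_dur (J : {set T}) t q s : perm_eq s (enum (Jl p w sel J t q)) ->
  sq p w sel J t q = t + dur s.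
Proof. by move=> h; rewrite (perm_dur _ _ h) /dur big_enum. Qed.

(** * Both parts of a valid cut inherit the invariant *)

Section Cut.

Variables (J : {set T}) (t : R) (q : nat).
Hypotheses (J_neq0 : J != set0) (t_ge0 : 0 <= t) (le_total : tend J t <= Defs.total p).
Hypotheses (cut : valid_cut J t q) (outside : unbanned_outside J t).

Local Notation a := (sel J t).
Local Notation sc := (sq p w sel J t q).

Lemma cut_left j : j \in Jl p w sel J t q ->
  [/\ j \in J, crosses J t a j & tstar a j + p j <= sc].
Proof.
case/andP: cut => hq /and3P[h1 h2 _].
by rewrite (mem_Jl _ _ _ _ _ J_neq0 hq h1 h2) => /and4P[].
Qed.

Lemma cut_ge_start : t <= sc.
Proof. by rewrite (sq_dur _ _ _ _ (perm_refl _)) lerDl dur_ge0. Qed.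

Lemma cut_lt_end : sc + p a <= tend J t.
Proof.
case/andP: cut => /andP[q0 _] _.
by rewrite -(sum_glue J t q) // (tend_dur _ _ _ (perm_refl _)) lerDl dur_ge0.
Qed.

(** A crossing job on the right has [sc < t* + p j]; since [sc] is not banned, even [sc < t*], so
    [alpha] beats it up to [sc]. *)
Lemma cut_right j : j \in Jr p w sel J t q ->
  forall u, t <= u <= sc -> 0 <= delta a j u.
Proof.
case/andP: (cut) => hq /and3P[h1 h2 nb] jr u /andP[u1 u2].
have ha := hsel J t J_neq0; have se := cut_lt_end; have pa := hp a.
have := jr; rewrite mem_Jr ?(andP hq).1 // => /and3P[jJ ja].
rewrite (mem_Jl _ _ _ _ _ J_neq0 hq h1 h2) jJ ja /=.
have [c /=|nc _] := boolP (crosses J t a j); last first.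
  by apply: (not_crosses_delta J t a) => //; rewrite u1; lra.
rewrite -ltNge => lt_s; apply/ltW/(crosses_delta_gt0 J t a) => //.
apply: le_lt_trans u2 _; rewrite ltNge; apply/negP => le_ts.
case/negP: nb; apply/existsP; exists j.
have k := crosses_slope _ _ _ t_ge0 ha _ jJ c.
case/andP: c => d /andP[ts1 ts2].
have ts0 : 0 < tstar a j by move: t_ge0; lra.
rewrite ja d ts0 le_ts lt_s (lt_le_trans ts2 le_total) /= !andbT.
by rewrite phi_ltE // delta_tstar // nmulr_rgt0 // sub0r oppr_lt0.
Qed.

(** At [sc] job [i] beats [alpha], which is no worse than any [j] of [J] outside the left part. By
    transitivity [delta i j >= 0] at [sc], whereas a ban at [s < sc] means that [j] has overtaken
    [i] by then. *)
Lemma unbanned_left : unbanned_outside (Jl p w sel J t q) t.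
Proof.
have ha := hsel J t J_neq0; have se := cut_lt_end; have pa := hp a.
have ts := cut_ge_start; have sc0 : 0 <= sc by move: t_ge0; lra.
case/andP: (cut) => /andP[q0 _] _.
move=> i j s il jl /andP[s1 s2]; have [iJ ci hi] := cut_left _ il.
have {}s2 : s < sc by []; apply/negP => b.
have [jJ|jJ] := boolP (j \in J); last first.
  have s12 : t <= s < tend J t by apply/andP; split; lra.
  by have := outside i j s iJ jJ s12; rewrite b.
have pi := hp i.
have ia : 0 < delta i a sc.
  by rewrite deltaC oppr_gt0 (crosses_delta_lt0 J t a) //; lra.
have dij : delta i j sc < 0.
  apply: (bans_delta_lt0 _ _ _ _ b); case/and4P: b => _ _ _ /andP[h _]; lra.
have aj : 0 <= delta a j sc.
  have [->|ja] := eqVneq j a; first by rewrite /delta subrr.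
  by apply: cut_right; rewrite ?ts ?lexx // mem_Jr // jJ ja.
by have := delta_trans i a j sc sc0 (ltW ia) aj; rewrite leNgt dij.
Qed.

(** A ban at [s] gives [tstar i j > s - p j], and [delta i j > 0] before [tstar i j]. For
    [j = alpha] this range contains [sc], where [alpha] is no worse than [i]. For [j] on the left it
    contains [tstar alpha j], where [j] ties with [alpha] and [alpha] is no worse than [i]. *)
Lemma unbanned_right : unbanned_outside (Jr p w sel J t q) (sc + p a).
Proof.
have ha := hsel J t J_neq0; have se := cut_lt_end; have pa := hp a.
have ts := cut_ge_start; have sc0 : 0 <= sc by move: t_ge0; lra.
case/andP: (cut) => /andP[q0 _] _.
move=> i j s ir jr; rewrite sum_glue // => /andP[s1 s2].
have := ir; rewrite mem_Jr // => /and3P[iJ ia _]; apply/negP => b.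
have [jJ|jJ] := boolP (j \in J); last first.
  have s12 : t <= s < tend J t by apply/andP; split; lra.
  by have := outside i j s iJ jJ s12; rewrite b.
have [_ _ _ /andP[_ lt_s]] := and4P b.
have [ja|ja] := eqVneq j a.
  have := cut_right _ ir sc; rewrite ts lexx => /(_ isT).
  rewrite leNgt -oppr_gt0 -deltaC -ja (bans_delta_gt0 _ _ _ _ b) //.
  by rewrite ja in lt_s *; lra.
have jl : j \in Jl p w sel J t q.
  by move: jr; rewrite mem_Jr // jJ ja /= negbK.
have [_ cj hj] := cut_left _ jl; have pj := hp j.
have [d /andP[u1 u2]] := andP cj; set u := tstar a j in hj u1 u2.
have u0 : 0 <= u by move: t_ge0; lra.
have ai : 0 <= delta a i u by apply: cut_right => //; apply/andP; split; lra.
have ja0 : 0 <= delta j a u by rewrite deltaC delta_tstar // subrr mulr0 oppr0.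
have := delta_trans j a i u u0 ja0 ai.
rewrite leNgt -oppr_gt0 -deltaC (bans_delta_gt0 _ _ _ _ b) //.
lra.
Qed.

End Cut.

(** The schedule of [good_schedule] is cut at the [q] bracketing the start [s] of [alpha]. A job of
    [J] banning [s] would cross, but crossing jobs have [t* + p_j <= s] or [s < t*]; other jobs are
    covered by the invariant. *)
Lemma optimal_cut (J : {set T}) t : J != set0 -> 0 <= t -> unbanned_outside J t ->
  exists q L N, [/\ valid_cut J t q, perm_eq L (enum (Jl p w sel J t q)),
    perm_eq N (enum (Jr p w sel J t q)) & optimal J t (L ++ sel J t :: N)].
Proof.
move=> J0 t0 out; have ha := hsel J t J0; have pa := hp (sel J t).
have [L [N [opt hL hN]]] := good_schedule J t (sel J t) t0 ha.
have [hs _] := optimalP _ _ _ opt.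
have us : uniq (L ++ sel J t :: N) by rewrite (perm_uniq hs) enum_uniq.
have mJ j : (j \in J) = [|| j \in L, j == sel J t | j \in N].
  by rewrite -mem_enum -(perm_mem hs) mem_cat inE.
move: us; rewrite cat_uniq /= negb_or => /and3P[uL /andP[aL dj] /andP[aN uN]].
pose s := t + dur L.
have sr : t <= s < tend J t.
  rewrite (tend_dur _ _ _ hs) dur_cat dur_cons /s.
  by have := dur_ge0 L; have := dur_ge0 N => h1 h2; apply/andP; split; lra.
have [q [hq h1 h2]] := cpoints_bracket J t s J0 sr.
have ml := fun j => mem_Jl J t q s j J0 hq h1 h2.
have pL : perm_eq L (enum (Jl p w sel J t q)).
  apply: uniq_perm; rewrite ?enum_uniq // => j; rewrite mem_enum ml mJ.
  have [jL|jL] /= := boolP (j \in L).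
    by rewrite hL // andbT; apply/esym; apply: contraNneq aL => <-.
  have [//|_] := eqVneq j (sel J t); rewrite /=.
  apply/esym/negP => /and3P[jN c le]; have := hN j jN c.
  by move: (hp j) le; rewrite -/s; lra.
have es : sq p w sel J t q = s by rewrite (sq_dur _ _ _ _ pL).
exists q, L, N; split => //; last first.
  apply: uniq_perm; rewrite ?enum_uniq // => j; rewrite mem_enum mem_Jr ?(andP hq).1 //.
  have -> : (j \in Jl p w sel J t q) = (j \in L) by rewrite (perm_mem pL) mem_enum.
  rewrite mJ; have [->|ja] /= := eqVneq j (sel J t); first by rewrite (negbTE aN) andbF.
  have [jL|jL] /= := boolP (j \in L); last by rewrite andbT.
  by apply: contraNF dj => jN; apply/hasP; exists j.
rewrite /valid_cut hq es h1 h2 /=; apply/negP => /in_banned_bans[j ja b].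
have [jJ|jJ] := boolP (j \in J); last first.
  by have := out (sel J t) j s (proj1 ha) jJ sr; rewrite b.
have c := bans_crosses _ _ _ _ _ t0 ha jJ (andP sr).2 b.
have [_ _ _ /andP[b1 b2]] := and4P b.
move: jJ; rewrite mJ (negbTE ja) => /orP[/hL/andP[_]|/hN/(_ c)]; rewrite -/s; lra.
Qed.

(** * Correctness of the recursion *)

Lemma bestP (cs : seq (R * seq T)) : cs != [::] ->
  exists2 b, best cs = Some b & b \in cs /\ forall c, c \in cs -> c.1 <= b.1.
Proof.
elim: cs => // c [|d cs] IH _.
  by exists c => //; rewrite mem_head; split=> // e; rewrite inE => /eqP->.
have [//|b eb [b1 b2]] := IH.
rewrite /best /= -/(best cs) in eb *; rewrite eb.
case: ifP => [le|/negbT]; [exists c|rewrite -ltNge => lt; exists b] => //.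
  rewrite mem_head; split=> // e; rewrite inE => /orP[/eqP->//|/b2 h].
  exact: le_trans le.
rewrite inE b1 orbT; split=> // e; rewrite inE => /orP[/eqP->|/b2//].
exact: ltW.
Qed.

Definition solves (r : option (R * seq T)) (J : {set T}) (t : R) : Prop :=
  exists v s, [/\ r = Some (v, s), v = sv t s & optimal J t s].

Definition candidate (n : nat) (J : {set T}) (t : R) (q : nat) : option (R * seq T) :=
  match fs p w sel n (Jl p w sel J t q) t,
        fs p w sel n (Jr p w sel J t q) (sq p w sel J t q + p (sel J t)) with
  | Some (vl, sl), Some (vr, sr) =>
      Some (vl + vr + w (sel J t) / (sq p w sel J t q + p (sel J t)),
            sl ++ sel J t :: sr)
  | _, _ => None
  end.

Lemma fsE n (J : {set T}) t : (1 < #|J|)%N -> fs p w sel n.+1 J t =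
  let cands := [seq candidate n J t q | q <- iota 1 (size (cpoints p w sel J t)).-1
                                      & valid_cut J t q] in
  if all isSome cands then best (pmap id cands) else None.
Proof.
case ek: #|J| => [|[|k]] // _; rewrite /= ek /=.
have -> // : [seq q <- iota 1 (size (cpoints p w sel J t)).-1 | valid_cut J t q] =
 [seq q <- iota 1 (size (cpoints p w sel J t)).-1 |
   [&& cpt p w sel J t q <= sq p w sel J t q,
      sq p w sel J t q < cpt p w sel J t q.+1
    & ~~ in_banned p w (sel J t) (sq p w sel J t q)]].
apply: eq_in_filter => q; rewrite mem_iota add1n /valid_cut => /andP[q0 q1].
rewrite q0 /=; case: (size _) q1 => [|m] /=; first by case: (q) q0.
by move=> ->.
Qed.

(** Induction on the fuel; both parts omit [alpha]. The invariant is carried through every valid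
    cut, not only an optimal one, since a single failing call makes the result [None]. *)
Lemma fs_solves n (J : {set T}) t : (#|J| <= n)%N -> 0 <= t ->
  tend J t <= Defs.total p -> unbanned_outside J t -> solves (fs p w sel n J t) J t.
Proof.
elim: n J t => [|n IH] J t Jn t0 tt out.
  move: Jn; rewrite leqn0 cards_eq0 => /eqP ->; rewrite /= cards0 /=.
  by exists 0, [::]; split=> //; apply: optimal_set0.
have [J1|] := ltnP 1 #|J|; last first.
  case ek: #|J| => [|[|//]] _; rewrite /= ek /=.
    move/eqP: ek; rewrite cards_eq0 => /eqP->.
    by exists 0, [::]; split=> //; apply: optimal_set0.
  move/eqP: ek => /cards1P[j ->].
  case: pickP => [i|/(_ j)]; last by rewrite inE eqxx.
  rewrite inE => /eqP->; exists (w j / (p j + t)), [:: j]; split => //=.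
    by rewrite addr0 addrC.
  exact: optimal_set1.
have J0 : J != set0 by rewrite -card_gt0 ltnW.
have [aJ _] := hsel J t J0; have pa := hp (sel J t).
have cand q : valid_cut J t q -> exists vl sl vr sr,
  [/\ candidate n J t q = Some (vl + vr + w (sel J t) / (sq p w sel J t q + p (sel J t)),
            sl ++ sel J t :: sr),
      vl = sv t sl /\ optimal (Jl p w sel J t q) t sl &
      vr = sv (sq p w sel J t q + p (sel J t)) sr /\
      optimal (Jr p w sel J t q) (sq p w sel J t q + p (sel J t)) sr].
  move=> cut; case/andP: (cut) => /andP[q0 _] _.
  have s1 := cut_ge_start J t q; have s2 := cut_lt_end J t q J0 cut.
  have sub (K : {set T}) : K \subset J :\ sel J t -> (#|K| <= n)%N.
    move=> /subset_leq_card; rewrite (cardsD1 (sel J t)) aJ in Jn.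
    by move=> h; apply: leq_trans h _.
  have [||||vl [sl [el hl ol]]] := IH (Jl p w sel J t q) t.
  - by apply: sub; apply/subsetP => j; rewrite !inE => /and3P[-> ->].
  - by [].
  - suff : sq p w sel J t q <= Defs.total p by []; lra.
  - exact: unbanned_left.
  have [||||vr [sr [er hr or]]] :=
    IH (Jr p w sel J t q) (sq p w sel J t q + p (sel J t)).
  - by apply: sub; apply/subsetP => j; rewrite mem_Jr // !inE => /and3P[-> ->].
  - lra.
  - by rewrite sum_glue.
  - exact: unbanned_right.
  by exists vl, sl, vr, sr; rewrite /candidate el er.
rewrite fsE //=; set cands := [seq _ | _ <- _ & _].
have -> : all isSome cands.
  apply/allP => c /mapP[q]; rewrite mem_filter => /andP[cut _] ->.
  by have [vl [sl [vr [sr [->]]]]] := cand q cut.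
have mc c : reflect (exists2 q, valid_cut J t q & candidate n J t q = Some c)
                    (c \in pmap id cands).
  rewrite mem_pmap map_id; apply: (iffP mapP) => [[q]|[q cut e]].
    by rewrite mem_filter => /andP[cut _] ->; exists q.
  exists q => //; rewrite mem_filter cut mem_iota add1n.
  by case/andP: cut => /andP[-> h] _; rewrite prednK // (leq_ltn_trans _ h).
(* This cut makes the candidate list nonempty, and its candidate is at least as good as the optimal
   schedule, whose two parts the recursive calls match or beat. *)
have [q0 [L [N [cut0 pL pN opt0]]]] := optimal_cut J t J0 t0 out.
have [vl0 [sl0 [vr0 [sr0 [e0 [hl0 /optimalP[_ ol0]] [hr0 /optimalP[_ or0]]]]]]] := cand q0 cut0.
have c0 := introT (mc _) (ex_intro2 _ _ q0 cut0 e0).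
have [|b eb [/mc[q cut ecand] bmax]] := bestP (pmap id cands).
  by apply/eqP => e; rewrite e in c0.
have [vl [sl [vr [sr [e [hl /optimalP[pl _]] [hr /optimalP[pr _]]]]]]] := cand q cut.
move: e; rewrite ecand => -[ebv]; rewrite eb ebv.
have ev : vl + vr + w (sel J t) / (sq p w sel J t q + p (sel J t)) =
  sv t (sl ++ sel J t :: sr).
  by rewrite sched_value_cat /= -(sq_dur _ _ _ _ pl) hl hr -addrA (addrC (sv _ sr)).
do 2!eexists; split; [reflexivity | exact: ev |].
apply/optimalP; split.
  by case/andP: cut => /andP[q1 _] _; apply: (perm_glue J t q).
move=> s' hs'; have [_ /(_ s' hs') le0] := optimalP _ _ _ opt0.
apply: le_trans le0 _; have := bmax _ c0; rewrite ebv /= -ev; apply: le_trans.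
rewrite sched_value_cat /= -(sq_dur _ _ _ _ pL) hl0 hr0.
by have := ol0 _ pL; have := or0 _ pN; lra.
Qed.

End FastScheduleOptimal.

Theorem theorem2 (R : realFieldType) (T : finType) (p w : T -> R)
  (hp : forall j, 0 < p j) (hw : forall j, 0 < w j)
  (sel : {set T} -> R -> T)
  (hsel : forall (J' : {set T}) (t : R), J' != set0 -> alpha_spec p w J' t (sel J' t)) :
  exists (v : R) (sigma : seq T),
    FastSchedule p w sel [set: T] 0 = Some (v, sigma) /\
    is_schedule sigma /\
    v = sched_value p w 0 sigma /\
    (forall s : seq T, is_schedule s -> sched_value p w 0 s <= sched_value p w 0 sigma).
Proof.
have eT : enum [set: T] = enum T by apply: eq_enum => j; rewrite inE.
have [||||v [s [e ev /optimalP[hs opt]]]] :=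
  fs_solves R T p w hp hw sel hsel #|[set: T]| [set: T] 0.
- by [].
- by [].
- by rewrite /t_end add0r /Defs.total; under eq_bigl do rewrite inE.
(* No job lies outside the full set, so the invariant holds vacuously. *)
- by move=> i j s _; rewrite inE.
rewrite eT in hs opt.
by exists v, s; split; [exact: e | split; [exact: hs | split; [exact: ev | exact: opt]]].
Qed.
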